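(* Let $1<p<\infty$ and put $Y=L_p[0,1]$. If $Z$ is a closed subspace of $\mathcal{B}(Y)$ containing $\mathcal{F}(Y)$, then $Z$ has the UBCP. In particular, $\mathcal{B}(L_p[0,1])$ has the UBCP.
   Context: $\mathcal{B}(Y)$ is the Banach space of bounded linear operators $Y\to Y$ with the operator norm, and $\mathcal{F}(Y)$ is its subspace of bounded finite-rank operators. Uniform ball-covering property (UBCP): a Banach space $Z$ with unit sphere $S_Z$ has the UBCP if there exist $r>0$ and a sequence $(z_j)_{j\ge1}$ in $Z$ such that $S_Z\subseteq\bigcup_{j\ge1}B(z_j,r)$ and $r<\inf_{j\ge1}\|z_j\|$, where $B(z,r)$ is the open ball with center $z$ and radius $r$. *)

(* Defs.v *)
From HB Require Import structures.
From mathcomp Require Import all_boot all_order all_algebra.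
From mathcomp Require Import all_classical all_reals all_analysis.
From mathcomp Require Import measurable_realfun ess_sup_inf.

Set Implicit Arguments.
Unset Strict Implicit.
Unset Printing Implicit Defensive.

Import Order.TTheory GRing.Theory Num.Theory.
Import numFieldNormedType.Exports.

Local Open Scope classical_set_scope.
Local Open Scope ring_scope.

(* The library defines LspaceType as the finite-norm classes of measurable
   functions modulo a.e. equality, without algebraic structure; it is turned
   below into a normedModType for the L^p norm, with operations computed on
   representatives. *)
Section LspaceNormedModule.
Context d (T : measurableType d) (R : realType).
Variables (mu : {measure set T -> \bar R}) (p : \bar R) (p1 : (1 <= p)%E).

Local Notation LfunT := (LfunType mu p1).
Local Notation Lp := (LspaceType mu p1).

Lemma ae_eq_Lnorm (f g : T -> R) : measurable_fun setT f ->
  measurable_fun setT g -> f = g %[ae mu] ->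
  ('N[mu]_p[EFin \o f] = 'N[mu]_p[EFin \o g])%E.
Proof.
move=> mf mg fg.
have mN (h : T -> R) r : measurable_fun setT h ->
    measurable_fun setT (fun x => `|(EFin \o h) x| `^ r)%E.
  move=> mh; apply: (@measurableT_comp _ _ _ _ _ _ (poweR ^~ r) _
      (fun x => `|(EFin \o h) x|)%E); first exact: measurable_poweR.
  by apply: measurableT_comp => //; exact/measurable_EFinP.
rewrite unlock /Lnorm; case: p p1 => [r r1|_|//].
  congr (_ `^ _)%E; apply: ae_eq_integral => //; try exact: mN.
  by apply: filterS fg => x /= /(_ I) ->.
case: ifPn => // _; apply: eq_ess_sup.
by apply: filterS fg => x /(_ I) /= ->.
Qed.

Lemma Lspace_Lfun_subproof (u : Lp) : (u : T -> R) \in hoelder.Lfun mu p.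
Proof.
apply/andP; split; rewrite inE /=; last exact: Lebesgue_finite.
exact: (@measurable_funPT _ _ _ _ (repr (LebesgueSpace.sort u))).
Qed.

Definition Lspace_repr (u : Lp) : LfunT := Lfun_Sub p1 (Lspace_Lfun_subproof u).

Lemma Lspace_reprE (u : Lp) : (Lspace_repr u : T -> R) = (u : T -> R).
Proof. by []. Qed.

Lemma measurable_funTypeR_subproof (f : LfunT) :
  @measurable_fun _ _ T (measurableTypeR R) setT (f : T -> R).
Proof. exact: (@measurable_funPT _ _ _ _ f). Qed.

(* R and measurableTypeR R have the same measurable sets but are different
   measurable structures. *)
Definition mfun_typeR (f : LfunT) : {mfun T >-> measurableTypeR R} :=
  HB.pack (f : T -> measurableTypeR R)
    (@isMeasurableFun.Build _ _ T (measurableTypeR R) (f : T -> R)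
      (measurable_funTypeR_subproof f)).

Definition aeclass (f : LfunT) : {mfun_ mu, T >-> measurableTypeR R} :=
  (\pi_({mfun_ mu, T >-> measurableTypeR R}) (mfun_typeR f))%qT.

Lemma aeclassK (f : LfunT) : (aeclass f : T -> R) = f %[ae mu].
Proof.
have : (aeclass f == \pi_({mfun_ mu, T >-> measurableTypeR R}) (mfun_typeR f))%qT by [].
by rewrite -[X in X == _]reprK eqmodE => /asboolP.
Qed.

Lemma aeclass_finite (f : LfunT) : finite_norm mu p (aeclass f).
Proof.
rewrite /finite_norm (@ae_eq_Lnorm _ f); [exact: Lfunction_finite| | |].
- exact: (@measurable_funPT _ _ _ _ (repr (aeclass f))).
- exact: measurable_funPT.
- exact: aeclassK.
Qed.

Definition Lspace_class (f : LfunT) : Lp :=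
  HB.pack (aeclass f)
    (@isFinLebesgue.Build _ T R mu p p1 (aeclass f) (aeclass_finite f)).

Lemma Lspace_classK (f : LfunT) : Lspace_repr (Lspace_class f) = f %[ae mu].
Proof. exact: aeclassK. Qed.

Lemma Lspace_eq (u v : Lp) : Lspace_repr u = Lspace_repr v %[ae mu] -> u = v.
Proof.
move=> uv.
have : LebesgueSpace.sort u = LebesgueSpace.sort v.
  apply/eqP; rewrite -[_ u]reprK -[_ v]reprK eqmodE; exact/asboolP.
case: u v {uv} => [u [[uP]]] [v [[vP]]] /= uv.
by case: _ / uv vP => vP; rewrite (Prop_irrelevance uP vP).
Qed.

Lemma Lspace_reprK (u : Lp) : Lspace_class (Lspace_repr u) = u.
Proof. by apply: Lspace_eq; exact: Lspace_classK. Qed.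

Lemma Lspace_class_eq (f g : LfunT) :
  f = g %[ae mu] -> Lspace_class f = Lspace_class g.
Proof.
move=> fg; apply: Lspace_eq.
apply: ae_eq_trans (Lspace_classK f) _; apply: ae_eq_trans fg _.
exact/ae_eq_sym/Lspace_classK.
Qed.

Definition Lspace_zero : Lp := Lspace_class 0.
Definition Lspace_opp (u : Lp) : Lp := Lspace_class (- Lspace_repr u).
Definition Lspace_add (u v : Lp) : Lp :=
  Lspace_class (Lspace_repr u + Lspace_repr v).
Definition Lspace_scale (a : R) (u : Lp) : Lp :=
  Lspace_class (a *: Lspace_repr u).
Definition Lspace_norm (u : Lp) : R := fine ('N[mu]_p[EFin \o u])%E.

Lemma Lspace_classD (f g : LfunT) :
  Lspace_add (Lspace_class f) (Lspace_class g) = Lspace_class (f + g).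
Proof.
apply: Lspace_class_eq.
apply: filterS2 (Lspace_classK f) (Lspace_classK g) => x fx gx _.
exact: (congr2 +%R (fx I) (gx I)).
Qed.

Lemma Lspace_classN (f : LfunT) :
  Lspace_opp (Lspace_class f) = Lspace_class (- f).
Proof.
apply: Lspace_class_eq; apply: filterS (Lspace_classK f) => x fx _.
exact: (congr1 -%R (fx I)).
Qed.

Lemma Lspace_classZ (a : R) (f : LfunT) :
  Lspace_scale a (Lspace_class f) = Lspace_class (a *: f).
Proof.
apply: Lspace_class_eq; apply: filterS (Lspace_classK f) => x fx _.
exact: (congr1 ( *%R a) (fx I)).
Qed.

Lemma Lspace_addA : associative Lspace_add.
Proof.
move=> u v w; rewrite -(Lspace_reprK u) -(Lspace_reprK v) -(Lspace_reprK w).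
by rewrite !Lspace_classD addrA.
Qed.

Lemma Lspace_addC : commutative Lspace_add.
Proof.
move=> u v; rewrite -(Lspace_reprK u) -(Lspace_reprK v).
by rewrite !Lspace_classD addrC.
Qed.

Lemma Lspace_add0 : left_id Lspace_zero Lspace_add.
Proof. by move=> u; rewrite -(Lspace_reprK u) Lspace_classD add0r. Qed.

Lemma Lspace_addN : left_inverse Lspace_zero Lspace_opp Lspace_add.
Proof.
by move=> u; rewrite -(Lspace_reprK u) Lspace_classN Lspace_classD addNr.
Qed.

HB.instance Definition _ := gen_eqMixin Lp.
HB.instance Definition _ := gen_choiceMixin Lp.
HB.instance Definition _ := GRing.isZmodule.Build Lp
  Lspace_addA Lspace_addC Lspace_add0 Lspace_addN.

Lemma Lspace_scaleA a b (u : Lp) :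
  Lspace_scale a (Lspace_scale b u) = Lspace_scale (a * b) u.
Proof. by rewrite -(Lspace_reprK u) !Lspace_classZ scalerA. Qed.

Lemma Lspace_scale1 : left_id 1 Lspace_scale.
Proof. by move=> u; rewrite -(Lspace_reprK u) Lspace_classZ scale1r. Qed.

Lemma Lspace_scaleDr : right_distributive Lspace_scale +%R.
Proof.
move=> a u v; rewrite -(Lspace_reprK u) -(Lspace_reprK v).
rewrite -[X in Lspace_scale a X]/(Lspace_add _ _) Lspace_classD !Lspace_classZ.
by rewrite scalerDr -Lspace_classD.
Qed.

Lemma Lspace_scaleDl u : {morph Lspace_scale^~ u : a b / a + b}.
Proof.
move=> a b /=; rewrite -(Lspace_reprK u) !Lspace_classZ scalerDl.
by rewrite -Lspace_classD.
Qed.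

HB.instance Definition _ := GRing.Zmodule_isLmodule.Build R Lp
  Lspace_scaleA Lspace_scale1 Lspace_scaleDr Lspace_scaleDl.

Lemma Lspace_norm_class (f : LfunT) :
  Lspace_norm (Lspace_class f) = fine ('N[mu]_p[EFin \o f])%E.
Proof.
congr fine; apply: ae_eq_Lnorm; last exact: aeclassK.
- exact: (@measurable_funPT _ _ _ _ (repr (aeclass f))).
- exact: measurable_funPT.
Qed.

Lemma Lspace_ler_normD (u v : Lp) :
  Lspace_norm (u + v) <= Lspace_norm u + Lspace_norm v.
Proof.
rewrite -(Lspace_reprK u) -(Lspace_reprK v).
rewrite -[X in Lspace_norm X]/(Lspace_add _ _) Lspace_classD.
by rewrite !Lspace_norm_class ler_LnormD.
Qed.

Lemma Lspace_normZ a (u : Lp) : Lspace_norm (a *: u) = `|a| * Lspace_norm u.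
Proof.
rewrite -(Lspace_reprK u) -[X in Lspace_norm X]/(Lspace_scale _ _).
rewrite Lspace_classZ !Lspace_norm_class.
apply: EFin_inj; rewrite EFinM !finite_norm_fine; exact: LnormZ.
Qed.

Lemma Lspace_norm0_eq0 (u : Lp) : Lspace_norm u = 0 -> u = 0.
Proof.
rewrite -(Lspace_reprK u) Lspace_norm_class => /fine_Lnormr_eq0 u0.
exact: Lspace_class_eq.
Qed.

HB.instance Definition _ := Lmodule_isNormed.Build R Lp
  Lspace_ler_normD Lspace_normZ Lspace_norm0_eq0.

End LspaceNormedModule.

Section BoundedOperators.
Context (R : realType) (V W : normedModType R).

Definition bounded_linear : {pred V -> W} :=
  mem [set f | linear f /\ bounded_fun_norm f].

Record boundedOp := BoundedOp {
  boundedOp_fun :> V -> W;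
  _ : boundedOp_fun \in bounded_linear
}.

HB.instance Definition _ := [isSub for boundedOp_fun].
HB.instance Definition _ := [Choice of boundedOp by <:].

Lemma bounded_linear_submod_closed : submod_closed bounded_linear.
Proof.
split=> [|a f g].
  rewrite inE; split=> [a x y|r]; first by rewrite /= scaler0 addr0.
  by exists 0 => x _; rewrite normr0.
rewrite !inE => -[lf bf] [lg bg]; split=> [b x y|r].
  have -> : (a *: f + g) (b *: x + y) =
    a *: f (b *: x + y) + g (b *: x + y) by [].
  rewrite lf lg !scalerDr !scalerA (mulrC a) -!scalerA !addrA.
  by congr (_ + _); rewrite addrAC.
have [M fM] := bf r; have [N gN] := bg r.
exists (`|a| * M + N) => x xr.
rewrite (le_trans (ler_normD _ _))// lerD ?gN//.
by rewrite normrZ ler_wpM2l ?fM.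
Qed.

HB.instance Definition _ := GRing.isSubmodClosed.Build _ _ bounded_linear
  bounded_linear_submod_closed.
HB.instance Definition _ := [SubChoice_isSubLmodule of boundedOp by <:].

Implicit Types S T : boundedOp.

Lemma boundedOp_linear T : linear T.
Proof. by have := valP T; rewrite inE => -[]. Qed.

Lemma boundedOp_bounded T : bounded_fun_norm T.
Proof. by have := valP T; rewrite inE => -[]. Qed.

HB.instance Definition _ T :=
  GRing.isLinear.Build R V W *:%R T (boundedOp_linear T).

Definition opnorm T : R := sup [set `|T x| | x in [set x : V | `|x| <= 1]].

Lemma opnorm_has_sup T : has_sup [set `|T x| | x in [set x : V | `|x| <= 1]].
Proof.
split; first by exists `|T 0|, 0; rewrite //= normr0.
by have [M TM] := boundedOp_bounded T 1; exists M => _ [x x1 <-]; exact: TM.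
Qed.

Lemma opnorm_ub T x : `|x| <= 1 -> `|T x| <= opnorm T.
Proof.
move=> x1; apply: ub_le_sup; first by case: (opnorm_has_sup T).
by exists x.
Qed.

Lemma opnorm_le T M : (forall x, `|x| <= 1 -> `|T x| <= M) -> opnorm T <= M.
Proof.
move=> TM; apply: ge_sup; first by case: (opnorm_has_sup T).
by move=> _ [x x1 <-]; exact: TM.
Qed.

Lemma opnorm_ge0 T : 0 <= opnorm T.
Proof. by rewrite (le_trans _ (@opnorm_ub T 0 _)) ?normr0. Qed.

Lemma le_opnorm T x : `|T x| <= opnorm T * `|x|.
Proof.
have [->|x0] := eqVneq x 0; first by rewrite linear0 !normr0 mulr0.
rewrite -ler_pdivrMr ?normr_gt0// mulrC.
have -> : `|x|^-1 * `|T x| = `|T (`|x|^-1 *: x)|.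
  by rewrite linearZ normrZ ger0_norm// invr_ge0.
by apply: opnorm_ub; rewrite normrZ normfV normr_id mulVf// normr_eq0.
Qed.

Lemma opnormD S T : opnorm (S + T) <= opnorm S + opnorm T.
Proof.
apply: opnorm_le => x x1; rewrite (le_trans (ler_normD _ _))//.
by rewrite lerD ?opnorm_ub.
Qed.

Lemma opnormZ_le a T : opnorm (a *: T) <= `|a| * opnorm T.
Proof.
by apply: opnorm_le => x x1; rewrite normrZ ler_wpM2l ?opnorm_ub.
Qed.

Lemma opnormZ a T : opnorm (a *: T) = `|a| * opnorm T.
Proof.
apply/eqP; rewrite eq_le opnormZ_le /=.
have [->|a0] := eqVneq a 0; first by rewrite normr0 mul0r opnorm_ge0.
rewrite -ler_pdivlMl ?normr_gt0// -normfV.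
by rewrite (le_trans _ (opnormZ_le _ _))// scalerA mulVf// scale1r.
Qed.

Lemma opnorm0_eq0 T : opnorm T = 0 -> T = 0.
Proof.
move=> T0; apply/val_inj/funext => x; apply/eqP.
by rewrite -normr_le0 (le_trans (le_opnorm T x))// T0 mul0r.
Qed.

HB.instance Definition _ := Lmodule_isNormed.Build R boundedOp
  opnormD opnormZ opnorm0_eq0.

Definition finite_rank : set boundedOp :=
  [set T | exists (n : nat) (e : 'I_n -> W), forall x, exists c : 'I_n -> R,
    T x = \sum_(i < n) c i *: e i].

End BoundedOperators.

Arguments finite_rank {R} V W.

(* Z is a linear subspace of E regarded as a normed space with the norm of E;
   the property of E itself is UBCP [set: E].  The centres z j are in Z, so
   using balls of E rather than of Z is immaterial. *)
Definition UBCP (R : realType) (E : normedModType R) (Z : set E) : Prop :=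
  exists (r : R) (z : nat -> E), [/\ 0 < r,
    forall j, Z (z j),
    Z `&` [set x | `|x| = 1] `<=` \bigcup_j ball (z j) r &
    r < inf (range (fun j => `|z j|))].

Section LpUnitInterval.
Context (R : realType).

(* Elements of L^p[0,1] are represented by functions on the whole line, taken
   modulo a.e. equality for Lebesgue measure restricted to [0, 1]; values
   outside [0, 1] are therefore irrelevant. *)
Definition lebesgue01 : {measure set (measurableTypeR R) -> \bar R} :=
  mrestr lebesgue_measure (measurable_itv `[0%R, 1%R]).

Lemma lt1_le1_EFin (p : R) : 1 < p -> (1 <= p%:E)%E.
Proof. by rewrite lee_fin => /ltW. Qed.

Definition Lp01 (p : R) (p1 : 1 < p) : normedModType R :=
  LspaceType lebesgue01 (lt1_le1_EFin p1).

End LpUnitInterval.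

(* Main.v *)
Require Import Defs.
From mathcomp Require Import all_boot all_order all_algebra.
From mathcomp Require Import all_classical all_reals all_analysis.
From mathcomp Require Import measurable_realfun.
From mathcomp Require Import ring lra.

Set Implicit Arguments.
Unset Strict Implicit.
Unset Printing Implicit Defensive.

Import Order.TTheory GRing.Theory Num.Theory.
Import numFieldNormedType.Exports.

Local Open Scope classical_set_scope.
Local Open Scope ring_scope.

(** The key is a perturbation estimate that only needs uniform convexity. Let
P be a norm-one projection of a uniformly convex space and T an operator with
norm at most 1. Uniform convexity gives d > 0 such that a unit-ball vector x
with |P x| >= 1 - d satisfies |x - P x| <= 1/4, because x and P x both lie in
the unit ball and P maps their midpoint to P x. Put l = 3 / d and test
T - l P T P on a vector x of the unit ball. If |P x| or |P T P x| is less than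
1 - d, then the large factor l - 1 in front of P T P x keeps the norm of the
image at most l - 1/2. Otherwise x is close to P x and T P x is close to
P T P x, so T x is close to P T P x and the image has norm at most
(l - 1) + 1/2. In all cases |T - l P T P| <= l - 1/2
(compression_perturbation). If |T| = 1 and P is large enough for P T P to have
norm close to 1, then |l P T P| is nearly l, so a ball around l P T P of radius
smaller than the norm of its centre contains T.

If P is a finite sum of rank one operators c_i (x) e_i, then P T P is a
combination of the finitely many operators c_i (x) e_j and can be approximated
by a combination with rational coefficients. With a sequence P_n of such
projections, countably many centres suffice for every T of norm 1
(UBCP_operators). They have finite rank, hence belong to every Z that contains
the finite rank operators.

For L^p[0,1] two facts remain. Uniform convexity comes from the tangent
inequality of the strictly convex function |x|^p: it yields the pointwise
estimate powR_clarkson, and integrating that estimate bounds |u - v|^p, up to a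
small multiple of |u|^p + |v|^p, by the convexity defect of the p-th power of
the norm at the midpoint (Lp_clarkson, Lp_uniformly_convex). The projections
are the averages over the n + 1 equal subintervals of [0,1[, which are
contractive by Jensen's inequality. Instead of proving their strong convergence
through a density argument, it is enough to know that liminf |P_n u| >= |u|:
uniform convexity upgrades this to P_n u --> u (projections_cvg). The lower
bound follows from the almost everywhere convergence given by Lebesgue's
differentiation theorem, together with Fatou's lemma (Lp_norm_lsc). *)

(** * Operators on a uniformly convex space *)

Section RankOne.
Context (R : realType) (V W : normedModType R).

Lemma boundedOp_sumE (I : Type) (r : seq I) (Q : pred I)
    (F : I -> boundedOp V W) (x : V) :
  (\sum_(i <- r | Q i) F i) x = \sum_(i <- r | Q i) F i x.
Proof. by elim/big_rec2: _ => // i _ S _ <-. Qed.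

Lemma rank_one_subproof (c : boundedOp V R^o) (e : W) :
  (fun x => (c x : R) *: e) \in @bounded_linear R V W.
Proof.
rewrite inE; split=> [a x y|r].
  by rewrite linearP /= scalerDl scalerA.
exists (opnorm c * `|r| * `|e|) => x xr.
rewrite normrZ ler_wpM2r// (le_trans (le_opnorm c x))//.
by rewrite ler_wpM2l ?opnorm_ge0// (le_trans xr)// ler_norm.
Qed.

(** The operator usually written c (x) e. *)
Definition rank_one (c : boundedOp V R^o) (e : W) : boundedOp V W :=
  BoundedOp (rank_one_subproof c e).

(** The combination of the operators c_i (x) e_j with coefficient matrix a; the
matrix is indexed by pairs so that it is a single finite family. *)
Definition tensor_comb (I : finType) (c : I -> boundedOp V R^o) (e : I -> W)
    (a : I * I -> R) : boundedOp V W :=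
  \sum_ij a ij *: rank_one (c ij.1) (e ij.2).

Lemma tensor_combE (I : finType) (c : I -> boundedOp V R^o) (e : I -> W)
    (a : I * I -> R) (x : V) :
  tensor_comb c e a x = \sum_j (\sum_i a (i, j) * c i x) *: e j.
Proof.
rewrite boundedOp_sumE.
transitivity (\sum_ij (a (ij.1, ij.2) * c ij.1 x) *: e ij.2).
  by apply: eq_bigr => -[i j] _; rewrite -scalerA.
rewrite -(pair_bigA _ (fun i j => (a (i, j) * c i x) *: e j)) exchange_big /=.
by apply: eq_bigr => j _; rewrite scaler_suml.
Qed.

Lemma tensor_comb_finite_rank n (c : 'I_n -> boundedOp V R^o)
    (e : 'I_n -> W) a :
  finite_rank V W (tensor_comb c e a).
Proof. by exists n, e => x; eexists; exact: tensor_combE. Qed.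

(** Finite-dimensional spans are separable: this is what makes the family of
centres countable. *)
Lemma rat_approx_comb (E : normedModType R) (I : finType) (b : I -> E)
    (a : I -> R) (eps : R) : 0 < eps ->
  exists q : {ffun I -> rat},
    `|\sum_i a i *: b i - \sum_i ratr (q i) *: b i| < eps.
Proof.
move=> eps0; pose B := 1 + \sum_i `|b i|.
have B0 : 0 < B by rewrite ltr_wpDr// sumr_ge0.
have dlt i : a i < a i + eps / B by rewrite ltrDl divr_gt0.
have /choice [q qP] : forall i, exists q : rat,
    ratr q \in `]a i, a i + eps / B[.
  by move=> i; exact: rat_in_itvoo.
exists (finfun q); rewrite -sumrB.
under eq_bigr do rewrite ffunE -scalerBl.
apply: (@le_lt_trans _ _ (\sum_i eps / B * `|b i|)).
  apply: (le_trans (ler_norm_sum _ _ _)); apply: ler_sum => i _.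
  rewrite normrZ ler_wpM2r// ler_norml.
  by have := qP i; rewrite in_itv /= => /andP[? ?]; apply/andP; split; lra.
rewrite -mulr_sumr mulrAC ltr_pdivrMr// ltr_pM2l//.
by rewrite /B ltrDr.
Qed.

End RankOne.

Section UniformConvexity.
Context (R : realType) (V : normedModType R).

(** Uniform convexity read contrapositively: midpoints close to the unit sphere
force the two vectors to be close. *)
Definition uniformly_convex := forall eps : R, 0 < eps ->
  exists2 d : R, 0 < d & forall x y : V, `|x| <= 1 -> `|y| <= 1 ->
    1 - d <= `|2^-1 *: (x + y)| -> `|x - y| <= eps.

Definition contractive_projection (P : boundedOp V V) :=
  (forall x, `|P x| <= `|x|) /\ (forall x, P (P x) = P x).

(** P maps the midpoint of x and P x to P x, so this midpoint has norm at least
|P x| and uniform convexity applies. *)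
Lemma projection_almost_fixed eps : uniformly_convex -> 0 < eps ->
  exists2 d : R, 0 < d <= 1 & forall P x, contractive_projection P ->
    `|x| <= 1 -> 1 - d <= `|P x| -> `|x - P x| <= eps.
Proof.
move=> uc eps0; have [d d0 dP] := uc _ eps0.
exists (Num.min d 1); first by rewrite lt_min d0 ltr01 ge_min lexx orbT.
move=> P x [Pc PP] x1 Px; apply: dP => //; first exact: le_trans (Pc x) x1.
have Pmid : P (2^-1 *: (x + P x)) = P x.
  rewrite linearZ linearD /= PP scalerDr -scalerDl -[2^-1]mul1r -splitr.
  by rewrite scale1r.
rewrite (le_trans _ (Pc _))// Pmid (le_trans _ Px)//.
by rewrite lerD2l lerN2 ge_min lexx.
Qed.

(** Q stands for the compression P T P. The factor 3 / d is chosen so that a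
loss of d in |Q x| is amplified enough to absorb the term |T x - Q x| <= 2. *)
Lemma compression_perturbation (d : R) (P T Q : boundedOp V V) :
  0 < d <= 1 ->
  (forall x, `|x| <= 1 -> 1 - d <= `|P x| -> `|x - P x| <= 4^-1) ->
  (forall x, `|P x| <= `|x|) -> `|T| <= 1 -> (forall x, Q x = P (T (P x))) ->
  `|T - (3 / d) *: Q| <= 3 / d - 2^-1.
Proof.
move=> /andP[d0 d1] Pfix Pc T1 QE; set l := 3 / d.
have ld : l * d = 3 by rewrite /l divfK// gt_eqF.
have l3 : 3 <= l by rewrite /l ler_pdivlMr// ler_piMr.
have Tc x : `|T x| <= `|x|.
  by rewrite (le_trans (le_opnorm T x))// ler_piMl.
apply: opnorm_le => x x1.
have -> : (T - l *: Q) x = (T x - Q x) - (l - 1) *: Q x.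
  by rewrite -[LHS]/(T x - l *: Q x) scalerBl scale1r opprB addrA subrK.
rewrite (le_trans (ler_normB _ _))// normrZ ger0_norm; last lra.
have Px1 : `|P x| <= 1 by exact: le_trans (Pc x) x1.
have TPx1 : `|T (P x)| <= 1 by exact: le_trans (Tc _) Px1.
have Q1 : `|Q x| <= 1 by rewrite QE; exact: le_trans (Pc _) TPx1.
(* Wherever Q x is short, the factor l - 1 gains about l * d = 3. *)
have small : `|Q x| <= 1 - d -> `|T x - Q x| + (l - 1) * `|Q x| <= l - 2^-1.
  move=> Qd; have h : (l - 1) * `|Q x| <= (l - 1) * (1 - d).
    by rewrite ler_wpM2l//; lra.
  have := ler_normB (T x) (Q x); have := le_trans (Tc x) x1.
  have : (l - 1) * (1 - d) = l - 1 - 3 + d by rewrite -ld; ring.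
  by move: h; lra.
have [Pxd|Pxd] := ltP `|P x| (1 - d).
  apply: small; rewrite QE (le_trans (Pc _))// (le_trans (Tc _))//.
  exact: ltW.
have [Qxd|Qxd] := ltP `|Q x| (1 - d); first exact/small/ltW.
(* Now P nearly fixes both x and T (P x), so T x is close to Q x. *)
have h1 := Pfix _ x1 Pxd.
have h2 : `|T (P x) - Q x| <= 4^-1.
  by rewrite QE; apply: Pfix => //; rewrite -QE.
have h3 : `|T x - T (P x)| <= 4^-1 by rewrite -linearB (le_trans (Tc _)).
have h4 : `|T x - Q x| <= 4^-1 + 4^-1.
  rewrite -(subrKA (T (P x))) (le_trans (ler_normD _ _))//.
  exact: lerD.
have h5 : (l - 1) * `|Q x| <= l - 1 by rewrite ler_piMr//; lra.
by move: h4 h5; lra.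
Qed.

End UniformConvexity.

Section Approximation.
Context (R : realType) (V : normedModType R) (N : nat -> nat).
Context (c : forall n, 'I_(N n) -> boundedOp V R^o)
  (e : forall n, 'I_(N n) -> V).
Context (P : nat -> boundedOp V V).
Hypothesis uc : uniformly_convex V.
Hypothesis PE : forall n x, P n x = \sum_i @c n i x *: @e n i.
Hypothesis Pproj : forall n, contractive_projection (P n).
Hypothesis Pinf : forall (x : V) (t : R), t < `|x| ->
  \forall n \near \oo, t < `|P n x|.

(** A lower bound on the norms alone gives strong convergence: after normalising
x, the vectors P n x eventually have norm above 1 - d. *)
Lemma projections_cvg (x : V) (eps : R) : `|x| <= 1 -> 0 < eps ->
  \forall n \near \oo, `|x - P n x| <= eps.
Proof.
move=> x1 eps0; have [->|x0] := eqVneq x 0.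
  by apply: nearW => n; rewrite linear0 subr0 normr0 ltW.
have nx0 : 0 < `|x| by rewrite normr_gt0.
have [d /andP[d0 _] dP] := projection_almost_fixed uc eps0.
have [v v1 xv] : exists2 v : V, `|v| = 1 & x = `|x| *: v.
  exists (`|x|^-1 *: x); last by rewrite scalerA divff ?scale1r// gt_eqF.
  by rewrite normrZ normfV normr_id mulVf// gt_eqF.
have dv : 1 - d < `|v| by rewrite v1; lra.
near=> n.
rewrite xv linearZ /= -scalerBr normrZ normr_id.
have h : `|v - P n v| <= eps.
  apply: dP; rewrite ?v1//; apply: ltW; near: n; exact: Pinf.
by rewrite (le_trans _ h)// ler_piMl.
Unshelve. all: by end_near. Qed.

(** The coefficients of the compression P T P in the operators c_i (x) e_j are
the matrix entries c_j (T e_i). *)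
Lemma compressionE n (T : boundedOp V V) (x : V) :
  tensor_comb (@c n) (@e n) (fun ij => @c n ij.2 (T (@e n ij.1))) x
  = P n (T (P n x)).
Proof.
rewrite tensor_combE [in RHS]PE; apply: eq_bigr => j _; congr (_ *: _).
rewrite PE !linear_sum /=; apply: eq_bigr => i _.
by rewrite !linearZ /= mulrC.
Qed.

Lemma compression_norm (T : boundedOp V V) (eps : R) : `|T| = 1 -> 0 < eps ->
  exists n, 1 - eps <=
    `|tensor_comb (@c n) (@e n) (fun ij => @c n ij.2 (T (@e n ij.1)))|.
Proof.
move=> T1 eps0.
have e2 : 0 < eps / 2 by rewrite divr_gt0.
have [_ [x x1 <-]] := sup_adherent e2 (opnorm_has_sup T).
rewrite -[sup _]/`|T| T1 => Tx.
have [n [h1 h2]] : exists n,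
    `|x - P n x| <= eps / 2 /\ 1 - eps / 2 < `|P n (T x)|.
  near \oo => n; exists n; split; near: n; first exact: projections_cvg.
  exact: Pinf.
exists n; set Q := tensor_comb _ _ _.
have Tc y : `|T y| <= `|y|.
  by rewrite (le_trans (le_opnorm T y))// ler_piMl// -[opnorm T]/`|T| T1.
have [Pc _] := Pproj n.
rewrite (le_trans _ (@opnorm_ub _ _ _ Q x x1))// compressionE.
have h3 : `|P n (T x) - P n (T (P n x))| <= eps / 2.
  by rewrite -!linearB (le_trans (Pc _))// (le_trans (Tc _)).
have := lerB_dist (P n (T x)) (P n (T (P n x))).
by move: h2 h3; lra.
Unshelve. all: by end_near. Qed.

(** A countable index type for the centres: the index n of a projection and a
rational matrix. *)
Definition center_code : countType :=
  {n : nat & {ffun 'I_(N n) * 'I_(N n) -> rat}}.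

Definition center (s : center_code) : boundedOp V V :=
  tensor_comb (@c (tag s)) (@e (tag s)) (fun ij => ratr (tagged s ij)).

(** The centres are the rational combinations of norm at least l - 1/4. For T of
norm 1 one of them approximates l P_n T P_n, where n is chosen such that
P_n T P_n has norm close to 1. *)
Theorem UBCP_operators (Z : set (boundedOp V V)) :
  (exists x : V, x != 0) -> finite_rank V V `<=` Z -> UBCP Z.
Proof.
move=> [x0 x00] FZ.
have q0 : 0 < (4^-1 : R) by rewrite invr_gt0.
have [d /andP[d0 d1] dP] := projection_almost_fixed uc q0.
set l : R := 3 / d.
have l3 : 3 <= l by rewrite /l ler_pdivlMr// ler_piMr.
(* A default centre, for the indices that decode to a short operator. *)
have [z0 Fz0 z0n] : exists2 z0, finite_rank V V z0 & l - 4^-1 <= `|z0|.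
  have [n Pn] : exists n, 0 < `|P n x0|.
    near \oo => n; exists n; near: n; apply: Pinf.
    by rewrite normr_gt0.
  have nP : 0 < `|P n|.
    rewrite normr_gt0; apply/eqP => P0.
    by move: Pn; rewrite P0 -[X in `|X|]/(0 : V) normr0 ltxx.
  exists ((l / `|P n|) *: P n).
    exists (N n), (@e n) => x; exists (fun i => l / `|P n| * @c n i x).
    rewrite -[LHS]/(_ *: P n x) PE scaler_sumr.
    by apply: eq_bigr => i _; rewrite scalerA.
  rewrite normrZ normrM normfV normr_id divfK ?gt_eqF// ger0_norm; lra.
pose z j : boundedOp V V :=
  if unpickle j is Some s then
    if l - 4^-1 <= `|center s| then center s else z0
  else z0.
have Fz j : finite_rank V V (z j).
  rewrite /z; case: (unpickle j) => // s; case: ifP => // _.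
  exact: tensor_comb_finite_rank.
have zn j : l - 4^-1 <= `|z j|.
  by rewrite /z; case: (unpickle j) => // s; case: ifP.
(* All centres have norm at least l - 1/4; the radius l - 3/8 leaves room for an
   approximation error above the distance l - 1/2 to the compression. *)
exists (l - 3 / 8), z; split; [by lra|by move=> j; exact: FZ| |].
  move=> T [_ /= T1].
  have eps0 : 0 < (16 * l)^-1 by rewrite invr_gt0; lra.
  have [n] := compression_norm T1 eps0.
  set a := fun ij => _; set Q := tensor_comb _ _ _ => Qn.
  have e16 : 0 < (16^-1 : R) by rewrite invr_gt0.
  have [q] := rat_approx_comb (fun ij => rank_one (@c n ij.1) (@e n ij.2))
    (fun ij => l * a ij) e16.
  have -> : \sum_i (l * a i) *: rank_one (@c n i.1) (@e n i.2) = l *: Q.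
    by rewrite scaler_sumr; apply: eq_bigr => ij _; rewrite scalerA.
  pose s : center_code := Tagged (fun n => {ffun 'I_(N n) * 'I_(N n) -> rat}) q.
  rewrite -[X in `|_ - X|]/(center s) => sQ.
  have TQ : `|T - l *: Q| <= l - 2^-1.
    have [Pc _] := Pproj n.
    apply: (@compression_perturbation _ _ d (P n)) => //.
    - by rewrite d0.
    - by move=> x x1; exact: dP.
    - by rewrite T1.
    - by move=> x; exact: compressionE.
  have lQ : l - 16^-1 <= `|l *: Q|.
    rewrite normrZ ger0_norm; last lra.
    have : l * (1 - (16 * l)^-1) <= l * `|Q| by rewrite ler_wpM2l//; lra.
    apply: le_trans; rewrite mulrBr mulr1 invfM mulrCA divff ?mulr1//.
    by rewrite gt_eqF//; lra.
  exists (pickle s) => //; rewrite /z pickleK ifT; last first.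
    by have := lerB_dist (l *: Q) (center s); move: sQ lQ; lra.
  rewrite -ball_normE /= -normrN opprB -(subrKA (l *: Q)).
  by rewrite (le_lt_trans (ler_normD _ _))//; move: sQ TQ; lra.
apply: (@lt_le_trans _ _ (l - 4^-1)); first lra.
apply: lb_le_inf; first by exists `|z 0%N|, 0%N.
by move=> _ [j _ <-].
Unshelve. all: by end_near. Qed.

End Approximation.

(** * Scalar inequalities for the p-th power *)

Section PowerInequalities.
Context (R : realType) (p : R).
Hypothesis p1 : 1 < p.

Let p0 : 0 < p. Proof. exact: lt_trans p1. Qed.

(** With y = expR s the claim reads p - (p - 1) expR (- s) < expR ((p - 1) s);
the line 1 + (p - 1) s separates the two sides, by 1 + t <= expR t used at
t = (p - 1) s and at t = - s. *)
Lemma powR_bernoulli (y : R) : 0 <= y -> y != 1 -> 1 + p * (y - 1) < y `^ p.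
Proof.
rewrite le_eqVlt => /predU1P[<- _|y0 y1].
  by rewrite powR0 ?gt_eqF//; move: p1; lra.
have [s s0 ->] : exists2 s, s != 0 & y = expR s.
  exists (ln y); last by rewrite lnK.
  by apply: contra y1 => /eqP s0; rewrite -(lnK y0) s0 expR0.
have h1 : 1 + (p - 1) * s <= expR ((p - 1) * s) by exact: expR_ge1Dx.
have h2 : 1 + (- s) < expR (- s) by rewrite expR_gt1Dx// oppr_eq0.
have h3 : p - (p - 1) * expR (- s) < expR ((p - 1) * s).
  have : (p - 1) * (1 + - s) < (p - 1) * expR (- s).
    by rewrite ltr_pM2l// subr_gt0.
  move: h1; nra.
have -> : expR s `^ p = expR s * expR ((p - 1) * s).
  by rewrite /powR gt_eqF ?expR_gt0// expRK -expRD; congr expR; ring.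
have E : expR s * expR (- s) = 1 by rewrite -expRD subrr expR0.
rewrite -(ltr_pM2l (expR_gt0 s)) in h3.
move: h3; rewrite mulrBr mulrCA E; lra.
Qed.

(** The derivative at m of the function |x|^p. *)
Definition dpowR (m : R) : R := p * (Num.sg m * `|m| `^ (p - 1)).

(** Bernoulli's inequality scaled by m. *)
Lemma powR_tangent_lt (x m : R) : 0 <= x -> 0 < m -> x != m ->
  m `^ p + p * m `^ (p - 1) * (x - m) < x `^ p.
Proof.
move=> x0 m0 xm.
have xE : x = m * (x / m) by rewrite mulrCA divff ?mulr1// gt_eqF.
have xm1 : x / m != 1 by apply: contra xm => /eqP h; rewrite xE h mulr1.
have := powR_bernoulli (divr_ge0 x0 (ltW m0)) xm1.
rewrite -(ltr_pM2l (powR_gt0 p m0)) -powRM ?divr_ge0 ?(ltW m0)// -xE.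
apply: le_lt_trans; rewrite -(mulr_powRB1 (ltW m0) p0) [in leLHS]xE.
by rewrite le_eqVlt; apply/orP; left; apply/eqP; ring.
Qed.

Lemma powR_tangent_ge0 (x m : R) : 0 <= x -> 0 <= m ->
  m `^ p + p * m `^ (p - 1) * (x - m) <= x `^ p.
Proof.
move=> x0; rewrite le_eqVlt => /predU1P[<-|m0].
  have pB1 : p - 1 != 0 by rewrite subr_eq0 gt_eqF.
  by rewrite (powR0 pB1) powR0 ?gt_eqF// mulr0 mul0r addr0 powR_ge0.
have [->|xm] := eqVneq x m; first by rewrite subrr mulr0 addr0.
exact/ltW/powR_tangent_lt.
Qed.

(** Passing to absolute values loses nothing, because sg m * x <= |x|. *)
Lemma powR_tangent (x m : R) :
  `|m| `^ p + dpowR m * (x - m) <= `|x| `^ p.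
Proof.
have := powR_tangent_ge0 (normr_ge0 x) (normr_ge0 m).
apply: le_trans; rewrite lerD2l /dpowR -!mulrA ler_pM2l//.
rewrite mulrCA ler_wpM2l ?powR_ge0// !mulrBr -normrEsg lerD2r.
rewrite (le_trans (ler_norm _))// normrM ler_piMl//.
by rewrite normr_sg lern1 leq_b1.
Qed.

(** The left-hand side is the gap at 1 between the power function and its
tangent at 1 - eta / 2. The tangent at the midpoint (1 + t) / 2, which lies
further to the left, leaves at least this gap at 1 and is below |t|^p at t. *)
Lemma powR_midpoint_gap (eta t : R) : 0 < eta -> eta <= 1 ->
  -1 <= t <= 1 - eta ->
  1 - ((1 - eta / 2) `^ p + p * (1 - eta / 2) `^ (p - 1) * (eta / 2))
  <= 1 + `|t| `^ p - 2 * ((1 + t) / 2) `^ p.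
Proof.
move=> eta0 eta1 /andP[t1 t2].
set m0 := 1 - eta / 2; set m := (1 + t) / 2.
have m0_ge0 : 0 <= m0 by rewrite /m0; lra.
have mge0 : 0 <= m by rewrite /m; lra.
have mm0 : m <= m0 by rewrite /m /m0; lra.
have h1 := powR_tangent t m.
rewrite (ger0_norm mge0) in h1.
have dm : dpowR m = p * m `^ (p - 1).
  rewrite /dpowR (ger0_norm mge0); congr (_ * _).
  move: mge0; rewrite le_eqVlt => /predU1P[<-|/gtr0_sg ->]; last first.
    by rewrite mul1r.
  by rewrite powR0 ?mulr0// subr_eq0 gt_eqF.
rewrite dm in h1.
have h2 := powR_tangent_ge0 m0_ge0 mge0.
have h3 : m `^ (p - 1) * (eta / 2) <= m0 `^ (p - 1) * (eta / 2).
  rewrite ler_pM2r ?divr_gt0// ge0_ler_powR// subr_ge0; exact: ltW.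
have h4 : p * (m `^ (p - 1) * (eta / 2)) <= p * (m0 `^ (p - 1) * (eta / 2)).
  by rewrite ler_pM2l.
move: h1 h2 h4; rewrite !mulrA.
have -> : t - m = - (1 - m) by rewrite /m; field.
have -> : m0 - m = (1 - m) - eta / 2 by rewrite /m0; ring.
set A := p * m `^ (p - 1); set B := p * m0 `^ _.
set X := m `^ p; set Y := m0 `^ p; lra.
Qed.

(** By homogeneity and symmetry a = 1 and b = t in [-1, 1]. For t close to 1 the
left-hand side is at most eps; for the other t the convexity defect is bounded
below by the gap k, so C = 2 ^ p / k works. *)
Lemma powR_clarkson (eps : R) : 0 < eps -> exists2 C : R, 0 <= C &
  forall a b : R, `|a - b| `^ p <= eps * (`|a| `^ p + `|b| `^ p) +
    C * (`|a| `^ p + `|b| `^ p - 2 * (`|a + b| / 2) `^ p).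
Proof.
move=> eps0.
have [eta /andP[eta0 eta1] etap] :
    exists2 eta : R, 0 < eta <= 1 & eta `^ p <= eps.
  have e0 : 0 < Num.min eps 1 <= 1.
    by rewrite lt_min eps0 ltr01 ge_min lexx orbT.
  exists (Num.min eps 1) => //; apply: (@le_trans _ _ (Num.min eps 1)).
    by rewrite ge1r_powR// ltW.
  by rewrite ge_min lexx.
pose k := 1 - ((1 - eta / 2) `^ p + p * (1 - eta / 2) `^ (p - 1) * (eta / 2)).
have k0 : 0 < k.
  have m0 : 0 < 1 - eta / 2 by lra.
  have m1 : 1 != 1 - eta / 2 by apply/eqP; lra.
  have := powR_tangent_lt ler01 m0 m1.
  by rewrite powR1 opprB addrCA subrr addr0 /k subr_gt0.
pose C := 2 `^ p / k.
have C0 : 0 <= C by rewrite divr_ge0 ?powR_ge0// ltW.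
have base (t : R) : -1 <= t <= 1 -> (1 - t) `^ p <= eps * (1 + `|t| `^ p) +
    C * (1 + `|t| `^ p - 2 * ((1 + t) / 2) `^ p).
  move=> /andP[tN1 t1].
  have [tm|tm] := leP t (1 - eta).
    have h : k <= 1 + `|t| `^ p - 2 * ((1 + t) / 2) `^ p.
      by apply: powR_midpoint_gap => //; rewrite tN1.
    have h1 : (1 - t) `^ p <= 2 `^ p.
      by apply: ge0_ler_powR; rewrite ?nnegrE ?(ltW p0)//; lra.
    have h2 : 2 `^ p <= C * (1 + `|t| `^ p - 2 * ((1 + t) / 2) `^ p).
      by apply: le_trans (ler_wpM2l C0 h); rewrite divfK// gt_eqF.
    apply: (le_trans h1); apply: (le_trans h2).
    by rewrite lerDr mulr_ge0 ?(ltW eps0)// addr_ge0 ?powR_ge0.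
  have h : 0 <= 1 + `|t| `^ p - 2 * ((1 + t) / 2) `^ p.
    have m0 : 0 <= (1 + t) / 2 by lra.
    have := powR_tangent t ((1 + t) / 2); have := powR_tangent 1 ((1 + t) / 2).
    rewrite normr1 powR1 (ger0_norm m0).
    have -> : t - (1 + t) / 2 = - (1 - (1 + t) / 2) by field.
    lra.
  have h1 : (1 - t) `^ p <= eps.
    apply: le_trans etap.
    by apply: ge0_ler_powR; rewrite ?nnegrE ?(ltW p0)//; lra.
  apply: (le_trans h1); apply: ler_wpDr; first exact: mulr_ge0.
  by rewrite ler_peMr ?(ltW eps0)// lerDl powR_ge0.
exists C => // a b; wlog ba : a b / `|b| <= `|a|.
  move=> H; have [ab|/ltW ab] := leP `|b| `|a|; first exact: H.
  by rewrite distrC (addrC a) (addrC (`|a| `^ p)); exact: H.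
have [a0|a0] := eqVneq a 0.
  have b0 : b = 0.
    by apply/normr0_eq0/le_anti; rewrite normr_ge0 -(normr0 R) -a0 ba.
  rewrite a0 b0 subrr addr0 normr0 mul0r powR0 ?gt_eqF// !(mulr0, addr0).
  by rewrite subrr mulr0.
have na0 : 0 < `|a| by rewrite normr_gt0.
have [t t1 bE] : exists2 t, -1 <= t <= 1 & b = a * t.
  exists (b / a); last by rewrite mulrCA divff ?mulr1.
  by rewrite -ler_norml normrM normfV ler_pdivrMr// mul1r.
have /andP[tN1 tle1] := t1.
have -> : a - b = a * (1 - t) by rewrite bE; ring.
have -> : `|a + b| / 2 = `|a| * ((1 + t) / 2).
  have -> : a + b = a * (1 + t) by rewrite bE; ring.
  by rewrite normrM (@ger0_norm _ (1 + t)) ?mulrA//; lra.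
have t1_ge0 : 0 <= 1 - t by lra.
have t2_ge0 : 0 <= (1 + t) / 2 by lra.
rewrite bE !normrM (ger0_norm t1_ge0).
rewrite (powRM p (normr_ge0 a) t1_ge0) (powRM p (normr_ge0 a) t2_ge0).
rewrite (powRM p (normr_ge0 a) (normr_ge0 t)).
have -> : eps * (`|a| `^ p + `|a| `^ p * `|t| `^ p) +
   C * (`|a| `^ p + `|a| `^ p * `|t| `^ p -
        2 * (`|a| `^ p * ((1 + t) / 2) `^ p))
   = `|a| `^ p * (eps * (1 + `|t| `^ p) +
    C * (1 + `|t| `^ p - 2 * ((1 + t) / 2) `^ p)) by ring.
by rewrite ler_wpM2l ?powR_ge0// base.
Qed.

End PowerInequalities.

(** * Uniform convexity of L^p *)

Section Rintegral_lincomb.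
Context d (T : measurableType d) (R : realType).
Context (mu : {measure set T -> \bar R}).

Lemma integrable_lincomb (D : set T) (f g : T -> R) (a b : R) : measurable D ->
  mu.-integrable D (EFin \o f) -> mu.-integrable D (EFin \o g) ->
  mu.-integrable D (EFin \o (fun x => a * f x + b * g x)).
Proof.
move=> mD If Ig.
by have := integrableD mD (integrableZl mD a If) (integrableZl mD b Ig).
Qed.

Lemma Rintegral_lincomb (D : set T) (f g : T -> R) (a b : R) : measurable D ->
  mu.-integrable D (EFin \o f) -> mu.-integrable D (EFin \o g) ->
  \int[mu]_(x in D) (a * f x + b * g x) =
  a * \int[mu]_(x in D) f x + b * \int[mu]_(x in D) g x.
Proof.
move=> mD If Ig; rewrite RintegralD ?RintegralZl//.
- exact: (integrableZl mD a If).
- exact: (integrableZl mD b Ig).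
Qed.

End Rintegral_lincomb.

Section LpSpaces.
Context d (T : measurableType d) (R : realType).
Variables (mu : {measure set T -> \bar R}) (p : R).
Hypothesis p1 : 1 < p.

Let pe := lt1_le1_EFin p1.
Let p0 : 0 < p. Proof. exact: lt_trans p1. Qed.

Local Notation Lp := (LspaceType mu pe).
Local Notation LfunT := (LfunType mu pe).

Lemma integrable_LfunT (f : LfunT) :
  mu.-integrable setT (EFin \o (fun x => `|f x| `^ p)).
Proof. by apply: Lfun_integrable; [exact: ltW|exact: LfunP]. Qed.

Lemma EFin_Lp_norm_class (f : LfunT) :
  (`|Lspace_class f| `^ p)%:E = (\int[mu]_x (`|f x| `^ p)%:E)%E.
Proof.
rewrite -[`|_|]/(Lspace_norm _) Lspace_norm_class -poweR_EFin.
by rewrite finite_norm_fine powR_Lnorm ?gt_eqF.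
Qed.

Lemma EFin_Lp_norm (u : Lp) :
  (`|u| `^ p)%:E = (\int[mu]_x (`|u x| `^ p)%:E)%E.
Proof. by rewrite -{1}(Lspace_reprK u) EFin_Lp_norm_class. Qed.

Lemma Lp_norm_classE (f : LfunT) :
  `|Lspace_class f| `^ p = \int[mu]_x (`|f x| `^ p).
Proof. by rewrite /Rintegral -EFin_Lp_norm_class. Qed.

Lemma Lp_normE (u : Lp) : `|u| `^ p = \int[mu]_x (`|u x| `^ p).
Proof. by rewrite /Rintegral -EFin_Lp_norm. Qed.

(** The pointwise estimate is linear in the p-th powers, hence it integrates to
the same estimate for norms. *)
Lemma Lp_clarkson (eps : R) : 0 < eps -> exists2 C : R, 0 <= C &
  forall u v : Lp, `|u - v| `^ p <= eps * (`|u| `^ p + `|v| `^ p) +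
    C * (`|u| `^ p + `|v| `^ p - 2 * `|2^-1 *: (u + v)| `^ p).
Proof.
move=> eps0; have [C C0 CP] := powR_clarkson p1 eps0.
exists C => // u v; rewrite -(Lspace_reprK u) -(Lspace_reprK v).
move: (Lspace_repr u) (Lspace_repr v) => f g.
have -> : Lspace_class f - Lspace_class g = Lspace_class (f - g).
  by rewrite -[LHS]/(Lspace_add _ (Lspace_opp _)) Lspace_classN Lspace_classD.
have -> : 2^-1 *: (Lspace_class f + Lspace_class g) =
    Lspace_class (2^-1 *: (f + g)).
  rewrite -[LHS]/(Lspace_scale _ (Lspace_add _ _)) Lspace_classD.
  by rewrite Lspace_classZ.
rewrite !Lp_norm_classE.
have If := integrable_LfunT f; have Ig := integrable_LfunT g.
have Im := integrable_LfunT (2^-1 *: (f + g)).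
have ID := integrable_LfunT (f - g).
have mT := @measurableT _ T.
have IS := integrable_lincomb 1 1 mT If Ig.
have := @le_Rintegral _ _ _ mu _ _ _ mT ID
  (integrable_lincomb (eps + C) (- (2 * C)) mT IS Im).
rewrite (Rintegral_lincomb _ _ mT IS Im) (Rintegral_lincomb _ _ mT If Ig).
move=> h; apply: le_trans (h _) _ => [x _|].
  have := CP (f x) (g x).
  have -> : `|f x + g x| / 2 = `|(2^-1 *: (f + g)) x|.
    rewrite -[(2^-1 *: (f + g)) x]/(2^-1 * (f x + g x)) normrM mulrC.
    by rewrite gtr0_norm ?invr_gt0.
  rewrite -[(f - g) x]/(f x - g x); move/le_trans; apply.
  move: (`|f x| `^ p) (`|g x| `^ p) (_ `^ p) => F G M.
  by rewrite le_eqVlt; apply/orP; left; apply/eqP; ring.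
move: (\int[mu]_x `|f x| `^ p) (\int[mu]_x `|g x| `^ p) (\int[mu]_x _ `^ p).
move=> F G M.
by rewrite le_eqVlt; apply/orP; left; apply/eqP; ring.
Qed.

Lemma Lp_uniformly_convex : uniformly_convex Lp.
Proof.
move=> eps eps0; have e4 : 0 < eps `^ p / 4 by rewrite divr_gt0 ?powR_gt0.
have [C C0 CP] := Lp_clarkson e4.
pose d0 := Num.min 1 (eps `^ p / (4 * (C * p + 1))).
have Cp : 0 < C * p + 1 by rewrite ltr_wpDl ?mulr_ge0// ltW.
have d2 : 4 * (C * p * d0) <= eps `^ p.
  have : d0 <= eps `^ p / (4 * (C * p + 1)) by rewrite /d0 ge_min lexx orbT.
  rewrite ler_pdivlMr; last by rewrite mulr_gt0.
  apply: le_trans.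
  have : 0 <= d0.
    by rewrite /d0 le_min ler01 divr_ge0 ?powR_ge0// ltW// mulr_gt0.
  by lra.
exists d0; first by rewrite lt_min ltr01 divr_gt0 ?powR_gt0// mulr_gt0.
move=> u v u1 v1 uv.
have powR_le1 (w : Lp) : `|w| <= 1 -> `|w| `^ p <= 1.
  move=> w1; apply: (@le_trans _ _ (1 `^ p)); last by rewrite powR1.
  by apply: ge0_ler_powR; rewrite ?nnegrE ?(ltW p0).
have hu := powR_le1 _ u1; have hv := powR_le1 _ v1.
have hm : 1 - p * d0 <= `|2^-1 *: (u + v)| `^ p.
  have := powR_tangent_ge0 p1 (normr_ge0 (2^-1 *: (u + v))) (@ler01 R).
  rewrite !powR1 mulr1; apply: le_trans.
  have : p * (1 - d0) <= p * `|2^-1 *: (u + v)| by rewrite ler_pM2l.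
  by lra.
have h := CP u v.
move: (`|u| `^ p) (`|v| `^ p) (`|_ *: _| `^ p) hu hv hm h => X Y M hu hv hm h.
(* d0 is chosen so that both terms of the estimate are at most eps ^ p / 2. *)
have h1 : eps `^ p / 4 * (X + Y) <= eps `^ p / 4 * 2.
  by rewrite ler_pM2l//; lra.
have h2 : C * (X + Y - 2 * M) <= C * (2 * (p * d0)) by rewrite ler_wpM2l//; lra.
have h3 : `|u - v| `^ p <= eps `^ p by move: h h1 h2 d2; lra.
rewrite leNgt; apply/negP => lt_uv; move: h3; rewrite leNgt => /negP; apply.
by apply: gt0_ltr_powR; rewrite ?nnegrE ?(ltW eps0).
Qed.

(** * The average over a set of finite measure as a functional on L^p *)

Section Average.
Variables (A : set T) (mA : measurable A) (Afin : (mu A < +oo)%E).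

Lemma integrable_cst1 : mu.-integrable A (EFin \o (cst 1 : T -> R)).
Proof.
rewrite (_ : _ \o _ = cst 1%E)//; apply/integrableP.
split; first exact: measurable_cst.
rewrite (_ : (fun x => _) = cst 1%E); last first.
  by apply/funext => x; rewrite /= normr1.
by rewrite integral_cst// mul1e.
Qed.

(** On a set of finite measure, |x| <= 1 + |x|^p replaces Hoelder's
inequality. *)
Lemma integrable_Lp_on (f : LfunT) : mu.-integrable A (EFin \o f).
Proof.
have If := integrable_LfunT f.
apply: le_integrable (integrable_lincomb 1 1 mA integrable_cst1
  (integrableS measurableT mA (@subsetT _ A) If)) => //.
  exact/measurable_EFinP/measurable_funTS/measurable_funPT.
move=> x _; rewrite /= !mul1r lee_fin [leRHS]ger0_norm ?addr_ge0 ?powR_ge0//.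
have [h|/ltW h] := leP `|f x| 1; first by rewrite ler_wpDr ?powR_ge0.
by rewrite ler_wpDl// le1r_powR// ltW.
Qed.

Lemma Rintegral_Lspace_class (f : LfunT) :
  \int[mu]_(x in A) (Lspace_class f x) = \int[mu]_(x in A) f x.
Proof.
congr fine; apply: ae_eq_integral => //.
- exact/measurable_EFinP/measurable_funTS/(measurable_funPT (Lspace_repr _)).
- exact/measurable_EFinP/measurable_funTS/measurable_funPT.
- by apply: filterS (Lspace_classK f) => x /= fx _; rewrite -fx.
Qed.

Definition average_fun (u : Lp) : R^o :=
  (fine (mu A))^-1 * \int[mu]_(x in A) u x.

Lemma average_fun_linear : linear average_fun.
Proof.
move=> a u v; rewrite -(Lspace_reprK u) -(Lspace_reprK v).
move: (Lspace_repr u) (Lspace_repr v) => f g.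
have -> : a *: Lspace_class f + Lspace_class g = Lspace_class (a *: f + g).
  rewrite -[LHS]/(Lspace_add (Lspace_scale _ _) _) Lspace_classZ.
  by rewrite Lspace_classD.
rewrite /average_fun !Rintegral_Lspace_class.
have := Rintegral_lincomb a 1 mA (integrable_Lp_on f) (integrable_Lp_on g).
under eq_Rintegral do rewrite mul1r.
rewrite mul1r => ->; rewrite -[_ *: _]/(a * _); ring.
Qed.

Lemma average_fun_bounded : bounded_fun_norm average_fun.
Proof.
move=> r; exists (`|(fine (mu A))^-1| * (fine (mu A) + `|r| `^ p)) => u ur.
rewrite normrM ler_wpM2l//.
have Iu := integrable_Lp_on (Lspace_repr u).
apply: (le_trans (le_normr_Rintegral mA Iu)).
have IpT := integrable_LfunT (Lspace_repr u).
have Ip := integrableS measurableT mA (@subsetT _ A) IpT.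
apply: (@le_trans _ _ (\int[mu]_(x in A) (1 * 1 + 1 * `|u x| `^ p))).
  apply: le_Rintegral => //; first exact: integrable_norm.
    by apply: integrable_lincomb => //; exact: integrable_cst1.
  move=> x _; rewrite !mul1r.
  have [h|/ltW h] := leP `|u x| 1; first by rewrite ler_wpDr ?powR_ge0.
  by rewrite ler_wpDl// le1r_powR// ltW.
rewrite (Rintegral_lincomb _ _ mA integrable_cst1 Ip) Rintegral_cst//.
rewrite !mul1r lerD2l.
apply: (@le_trans _ _ (`|u| `^ p)).
  rewrite Lp_normE; apply: fine_le.
  - exact: integrable_fin_num Ip.
  - exact: integrable_fin_num IpT.
  - apply: ge0_subset_integral => //; exact: measurable_int IpT.
by rewrite (@ge0_ler_powR _ p)// ?nnegrE ?(ltW p0)// (le_trans ur)// ler_norm.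
Qed.

Lemma average_subproof : average_fun \in @bounded_linear R Lp R^o.
Proof.
by rewrite inE; split; [exact: average_fun_linear|exact: average_fun_bounded].
Qed.

Definition average : boundedOp Lp R^o := BoundedOp average_subproof.

Lemma indic_Lfun_subproof : (\1_A : T -> R) \in Lfun mu p%:E.
Proof.
apply/andP; split; rewrite inE /=; first exact: measurable_indic.
rewrite /finite_norm unlock poweR_lty//.
rewrite (eq_integral (fun x => (\1_A x)%:E)) => [|x _]; last first.
  congr EFin; rewrite indicE; case: (_ \in _) => /=.
    by rewrite normr1 powR1.
  by rewrite normr0 powR0// gt_eqF.
by rewrite integral_indic// setIT.
Qed.

Definition indic_Lfun : LfunT := Lfun_Sub pe indic_Lfun_subproof.

Definition indic_class : Lp := Lspace_class indic_Lfun.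

End Average.

End LpSpaces.

(** * Lower semicontinuity of the L^p norm *)

Section LimnEinf.
Context (R : realType).
Implicit Types (v : (\bar R)^nat) (l : \bar R).

Lemma limn_einfE v : limn_einf v = ereal_sup (range (einfs v)).
Proof. by rewrite limn_einf_lim; exact/cvg_lim/cvg_einfs_sup. Qed.

Lemma near_le_limn_einf v l :
  (\forall n \near \oo, (l <= v n)%E) -> (l <= limn_einf v)%E.
Proof.
move=> [m _ lv]; rewrite limn_einfE.
apply: (@le_trans _ _ (einfs v m)); last by apply: ereal_sup_ubound; exists m.
by apply: le_ereal_inf_tmp => _ [n /= mn <-]; exact: lv.
Qed.

Lemma lt_limn_einf_near v l :
  (l < limn_einf v)%E -> \forall n \near \oo, (l < v n)%E.
Proof.
rewrite limn_einfE => /ereal_sup_gt[_ [m _ <-]] lm; exists m => // n /= mn.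
by apply: (lt_le_trans lm); apply: ereal_inf_lbound; exists n.
Qed.

End LimnEinf.

Section LpLsc.
Context d (T : measurableType d) (R : realType).
Variables (mu : {measure set T -> \bar R}) (p : R).
Hypothesis p1 : 1 < p.

Let pe := lt1_le1_EFin p1.
Let p0 : 0 < p. Proof. exact: lt_trans p1. Qed.

Local Notation Lp := (LspaceType mu pe).
Local Notation LfunT := (LfunType mu pe).

(** The tangent at l bounds |s n|^p below by a sequence tending to |l|^p. *)
Lemma powR_norm_le_liminf (s : nat -> R) (l : R) : s @ \oo --> l ->
  ((`|l| `^ p)%:E <= limn_einf (fun n => (`|s n| `^ p)%:E))%E.
Proof.
move=> sl; apply/lee_addgt0Pr => e e0; rewrite -leeBlDr//.
apply: near_le_limn_einf.
have : (fun n => dpowR p l * (s n - l)) @ \oo --> dpowR p l * (l - l).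
  by apply: cvgM; [exact: cvg_cst|apply: cvgB => //; exact: cvg_cst].
rewrite subrr mulr0 => /cvgr0Pnorm_le/(_ _ e0) near_e.
apply: filterS near_e => n se; rewrite -EFinB lee_fin.
apply: le_trans (powR_tangent p1 (s n) l); rewrite lerD2l.
by move: se; rewrite ler_norml => /andP[].
Qed.

(** Fatou's lemma for the p-th powers. *)
Lemma Lp_norm_lsc (f : nat -> LfunT) (u : Lp) (t : R) :
  {ae mu, forall x, f n x @[n --> \oo] --> u x} -> t < `|u| ->
  \forall n \near \oo, t < `|Lspace_class (f n)|.
Proof.
move=> fu tu; have [t0|t0] := ltP t 0.
  by apply: nearW => n; exact: lt_le_trans t0 _.
pose F n x := (`|f n x| `^ p)%:E.
have mF n : measurable_fun setT (F n).
  exact: measurable_int (integrable_LfunT (f n)).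
have mU : measurable_fun setT (fun x => (`|u x| `^ p)%:E).
  exact: measurable_int (integrable_LfunT (Lspace_repr u)).
have : ((t `^ p)%:E < limn_einf (fun n => (`|Lspace_class (f n)| `^ p)%:E))%E.
  apply: (@lt_le_trans _ _ ((`|u| `^ p)%:E)).
    by rewrite lte_fin; apply: gt0_ltr_powR; rewrite ?nnegrE.
  rewrite EFin_Lp_norm.
  apply: (@le_trans _ _ (\int[mu]_x limn_einf (F^~ x))%E).
    apply: ae_ge0_le_integral => //.
    - move=> x _; apply: near_le_limn_einf; apply: nearW => n.
      by rewrite /F lee_fin powR_ge0.
    - apply: measurableT_comp => //; apply: measurable_fun_limn_esup => n.
      exact: measurableT_comp.
    - by apply: filterS fu => x fx _; exact: powR_norm_le_liminf.
  under [X in (_ <= limn_einf X)%E]eq_fun do rewrite EFin_Lp_norm_class.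
  by apply: fatou => // n x _; rewrite /F lee_fin powR_ge0.
move=> /lt_limn_einf_near; apply: filterS => n; rewrite lte_fin => h.
rewrite ltNge; apply/negP => le_t; move: h; rewrite ltNge => /negP; apply.
by rewrite (@ge0_ler_powR _ p)// ?nnegrE ?(ltW p0).
Qed.

End LpLsc.

(** * Averaging projections *)

Section LpAverages.
Context d (T : measurableType d) (R : realType).
Variables (mu : {measure set T -> \bar R}) (p : R).
Hypothesis p1 : 1 < p.

Let pe := lt1_le1_EFin p1.
Let p0 : 0 < p. Proof. exact: lt_trans p1. Qed.

Local Notation Lp := (LspaceType mu pe).
Local Notation LfunT := (LfunType mu pe).

Section Averages.
Context (I : finType) (A : I -> set T).
Hypothesis mA : forall i, measurable (A i).
Hypothesis Afin : forall i, (mu (A i) < +oo)%E.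
Hypothesis A0 : forall i, (0 < mu (A i))%E.
Hypothesis Adisj : forall i j x, A i x -> A j x -> i = j.

Local Notation avg i := (average p1 (mA i) (Afin i)).
Local Notation ind i := (indic_class p1 (mA i) (Afin i)).

Let muA_gt0 i : 0 < fine (mu (A i)).
Proof. by rewrite fine_gt0// A0 Afin. Qed.

Let EFin_muA i : (fine (mu (A i)))%:E = mu (A i).
Proof. by rewrite fineK// ge0_fin_numE. Qed.

(** On the union of the A i this is the conditional expectation onto the algebra
they generate; elsewhere it is zero. *)
Definition averages : boundedOp Lp Lp := \sum_i rank_one (avg i) (ind i).

Lemma averagesE u : averages u = \sum_i avg i u *: ind i.
Proof. by rewrite boundedOp_sumE. Qed.

Lemma average_indic i j : avg j (ind i) = (i == j)%:R.
Proof.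
rewrite -[LHS]/(_ * _) Rintegral_Lspace_class// /Rintegral integral_indic//.
have [->|ij] := eqVneq i j; first by rewrite setIid mulVf// gt_eqF.
rewrite (_ : _ `&` _ = set0) ?measure0 ?mulr0//.
by apply/seteqP; split => // x [/Adisj h /h]; apply/eqP.
Qed.

Lemma averages_idem u : averages (averages u) = averages u.
Proof.
rewrite !averagesE; apply: eq_bigr => j _; congr (_ *: _).
have -> : avg j (\sum_i avg i u *: ind i) = \sum_i avg i u * (i == j)%:R.
  rewrite linear_sum; apply: eq_bigr => i _; rewrite -average_indic.
  exact: linearZ.
by rewrite (bigD1 j)//= eqxx mulr1 big1 ?addr0// => i /negbTE ->; rewrite mulr0.
Qed.

Lemma Lspace_class_sum (a : I -> R) (f : I -> LfunT) :
  \sum_i a i *: Lspace_class (f i) = Lspace_class (\sum_i a i *: f i).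
Proof.
apply: (big_ind2 (fun u g => u = Lspace_class g)) => // [_ f1 _ f2 -> ->|i _].
  exact: Lspace_classD.
exact: Lspace_classZ.
Qed.

Definition step (a : I -> R) : LfunT :=
  \sum_i a i *: indic_Lfun p1 (mA i) (Afin i).

Lemma stepE a x : step a x = \sum_i a i * \1_(A i) x.
Proof. by rewrite /step; elim/big_rec2: _ => // i _ g _ <-. Qed.

Lemma sum_indicE (a : I -> R) i x : A i x -> \sum_j a j * \1_(A j) x = a i.
Proof.
move=> Aix; rewrite (bigD1 i)//= big1 => [|j ji].
  by rewrite indicE mem_set// mulr1 addr0.
rewrite indicE memNset ?mulr0// => /Adisj/(_ Aix) E.
by rewrite E eqxx in ji.
Qed.

Lemma averages_step u : averages u = Lspace_class (step (fun i => avg i u)).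
Proof. by rewrite averagesE Lspace_class_sum. Qed.

Lemma average_stepE u i x : A i x -> step (fun i => avg i u) x = avg i u.
Proof. by move=> Aix; rewrite stepE (sum_indicE _ Aix). Qed.

Lemma step_Lp_norm (a : I -> R) :
  (`|Lspace_class (step a)| `^ p)%:E = (\sum_i (`|a i| `^ p)%:E * mu (A i))%E.
Proof.
rewrite EFin_Lp_norm_class.
transitivity (\int[mu]_x (\sum_i (`|a i| `^ p)%:E * (\1_(A i) x)%:E))%E.
  apply: eq_integral => x _; rewrite sumEFin stepE; congr EFin.
  have [[i Aix]|noA] := pselect (exists i, A i x).
    by rewrite (sum_indicE _ Aix) (sum_indicE (fun i => `|a i| `^ p) Aix).
  have noA1 i : \1_(A i) x = 0 :> R.
    by rewrite indicE memNset// => ?; apply: noA; exists i.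
  rewrite !big1 => [|i _|i _]; rewrite ?noA1 ?mulr0//.
  by rewrite normr0 powR0// gt_eqF.
rewrite ge0_integral_sum//.
- apply: eq_bigr => i _; rewrite ge0_integralZl// ?lee_fin ?powR_ge0//.
  + by rewrite integral_indic// setIT.
  + exact/measurable_EFinP/measurable_indic.
- by move=> i; apply: measurable_funeM; exact/measurable_EFinP/measurable_indic.
Qed.

(** Integrate over A i the tangent inequality at the average a: the linear term
has integral zero. *)
Lemma jensen_average i (u : Lp) :
  ((`|avg i u| `^ p)%:E * mu (A i) <= \int[mu]_(x in A i) (`|u x| `^ p)%:E)%E.
Proof.
set a := avg i u.
have Iu := integrable_Lp_on (mA i) (Afin i) (Lspace_repr u).
have Iup := integrableS measurableT (mA i) (@subsetT _ (A i))
  (integrable_LfunT (Lspace_repr u)).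
have Ic := integrable_cst1 (mA i) (Afin i).
rewrite -EFin_muA -EFinM -[leRHS]fineK; last exact: integrable_fin_num Iup.
rewrite lee_fin.
have muI : a * fine (mu (A i)) = \int[mu]_(x in A i) u x.
  by rewrite /a -[avg i u]/(_ * _) mulrAC mulVf ?mul1r// gt_eqF.
have := @le_Rintegral _ _ _ mu _ _ _ (mA i)
  (integrable_lincomb (`|a| `^ p - dpowR p a * a) (dpowR p a) (mA i) Ic Iu) Iup.
rewrite (Rintegral_lincomb _ _ (mA i) Ic Iu) Rintegral_cst// mul1r -muI.
move=> h; apply: le_trans (h _) => [|x _].
  by rewrite mulrBl -[_ * a * _]mulrA subrK.
apply: le_trans (powR_tangent p1 (u x) a).
have E (P D b y : R) : P + D * (y - b) = (P - D * b) * 1 + D * y by ring.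
by rewrite E.
Qed.

(** The p-th power of the norm of a step function is a sum over the pieces, each
bounded by Jensen's inequality. *)
Lemma averages_le u : `|averages u| <= `|u|.
Proof.
rewrite leNgt; apply/negP => lt_u.
have : `|u| `^ p < `|averages u| `^ p by apply: gt0_ltr_powR; rewrite ?nnegrE.
apply/negP; rewrite -leNgt -lee_fin averages_step step_Lp_norm.
rewrite (le_trans (lee_sum _ (fun i _ => jensen_average i u)))//.
have mup : measurable_fun setT (fun x => (`|u x| `^ p)%:E).
  exact: measurable_int (integrable_LfunT (Lspace_repr u)).
rewrite -ge0_integral_bigsetU//.
- rewrite EFin_Lp_norm.
  by apply: ge0_subset_integral => //; exact: bigsetU_measurable.
- exact: index_enum_uniq.
- by move=> i j _ _ [x [/Adisj h /h]].
- exact: measurable_funTS.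
Qed.

Lemma averages_projection : contractive_projection averages.
Proof. by split; [exact: averages_le|exact: averages_idem]. Qed.

End Averages.
End LpAverages.

(** * Averages over the regular subdivisions of the unit interval *)

Section UnitInterval.
Context (R : realType).
Local Notation leb := (@lebesgue_measure R).
Local Notation l01 := (@lebesgue01 R).

(** The real parameter t, instead of an index k <= n, lets the cells subdivide
the whole line: Lebesgue's differentiation theorem asks for shrinking sets at
every real point. *)
Definition cell (n : nat) (t : R) : set (measurableTypeR R) :=
  `[t / n.+1%:R, (t + 1) / n.+1%:R[%classic.

Lemma cellP n t x : cell n t x <-> t <= x * n.+1%:R < t + 1.
Proof.
by rewrite /cell /= in_itv/= ler_pdivrMr ?ltr0n// ltr_pdivlMr ?ltr0n.
Qed.

Lemma measurable_cell n t : measurable (cell n t).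
Proof. exact: measurable_itv. Qed.

Lemma lebesgue_cell n t : leb (cell n t) = (n.+1%:R^-1)%:E.
Proof.
rewrite /cell lebesgue_measure_itv /= lte_fin ltr_pM2r ?invr_gt0 ?ltr0n//.
by rewrite ltrDl ltr01 -EFinB -mulrBl addrAC subrr add0r mul1r.
Qed.

Definition cell_at n (x : R) := cell n (Num.floor (x * n.+1%:R))%:~R.

Lemma cell_at_in n x : cell_at n x x.
Proof. by apply/cellP; have := floor_itv (x * n.+1%:R); rewrite intrD. Qed.

Lemma nicely_shrinking_cell_at x : nicely_shrinking x (cell_at ^~ x).
Proof.
split=> [n|]; first exact: measurable_cell.
exists (2, (fun n => (n.+1%:R^-1)%:pos)); split => //= [|n y|n].
- exact: cvg_harmonic.
- move=> /cellP/andP[y1 y2]; have /cellP/andP[x1 x2] := cell_at_in n x.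
  rewrite /ball /= -[X in _ < X]mul1r ltr_pdivlMr ?ltr0n//.
  rewrite -[X in _ * X](@ger0_norm R)// -normrM mulrBl ltr_norml.
  by apply/andP; split; lra.
- by rewrite lebesgue_measure_ball// lebesgue_cell -EFinM mulr_natl.
Qed.

Local Notation unit_itv := (`[0, 1]%classic : set (measurableTypeR R)).

Lemma measurable_unit_itv : measurable unit_itv.
Proof. exact: measurable_itv. Qed.

Lemma lebesgue01E (B : set (measurableTypeR R)) :
  B `<=` unit_itv -> l01 B = leb B.
Proof. by move=> B01; rewrite -[LHS]/(leb (_ `&` _)) setIidl. Qed.

Lemma lebesgue01_integral (f : R -> \bar R) (B : set (measurableTypeR R)) :
  B `<=` unit_itv -> (\int[l01]_(x in B) f x = \int[leb]_(x in B) f x)%E.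
Proof.
move=> B01; apply: eq_measure_integral => C _ CB.
by apply: lebesgue01E; exact: subset_trans B01.
Qed.

Lemma cell_sub_unit_itv n (i : 'I_n.+1) : cell n i%:R `<=` unit_itv.
Proof.
move=> x /cellP/andP[k1 k2]; rewrite /= in_itv /=.
have n0 : 0 < n.+1%:R :> R by rewrite ltr0n.
rewrite -(pmulr_lge0 x n0) (le_trans _ k1)//=.
rewrite -(ler_pM2r n0) mul1r (le_trans (ltW k2))// -natr1 lerD2r ler_nat.
by rewrite -ltnS.
Qed.

Lemma lebesgue01_cell n (k : 'I_n.+1) : l01 (cell n k%:R) = (n.+1%:R^-1)%:E.
Proof.
rewrite -(lebesgue_cell n k%:R) lebesgue01E//; exact: cell_sub_unit_itv.
Qed.

Lemma cell_disjoint n (i j : 'I_n.+1) x :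
  cell n i%:R x -> cell n j%:R x -> i = j.
Proof.
move=> /cellP/andP[i1 i2] /cellP/andP[j1 j2]; apply/val_inj/anti_leq.
rewrite -ltnS -[X in _ && X]ltnS -!(ltr_nat R) -!natr1.
by rewrite (le_lt_trans i1 j2) (le_lt_trans j1 i2).
Qed.

Lemma cell_atE n x : 0 <= x < 1 ->
  exists i : 'I_n.+1, cell_at n x = cell n i%:R.
Proof.
move=> /andP[x0 x1]; have n0 : 0 < n.+1%:R :> R by rewrite ltr0n.
have := floor_ge0 (x * n.+1%:R); rewrite mulr_ge0 ?(ltW n0)//.
have : x * n.+1%:R < (n.+1 : int)%:~R by rewrite -[X in _ < X]mul1r ltr_pM2r.
rewrite -floor_lt_int /cell_at; case: Num.floor => // m mn _.
by exists (Ordinal mn).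
Qed.

Lemma ae_lebesgue01 (Q : set R) :
  {ae leb, forall x, Q x} -> {ae l01, forall x, Q x}.
Proof.
move=> [N [mN N0 QN]]; exists N; split=> //.
apply/eqP; rewrite eq_le measure_ge0 andbT -N0.
apply: (@le_measure _ _ _ leb); last exact: subIsetl.
  by rewrite inE; apply: measurableI => //; exact: measurable_itv.
by rewrite inE.
Qed.

Lemma ae_unit_interval : {ae l01, forall x, 0 <= x < 1}.
Proof.
exists (~` `[0, 1[%classic); split.
- by apply: measurableC; exact: measurable_itv.
- rewrite -[LHS]/(leb (_ `&` _)) (_ : _ `&` _ = [set 1]).
    exact: lebesgue_measure_set1.
  apply/seteqP; split=> x /=; rewrite !in_itv /=.
    move=> [/negP + /andP[x0 x1]]; rewrite x0 /= -leNgt => ?.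
    exact/le_anti/andP.
  by move=> ->; rewrite ltxx ler01 lexx; split.
- by move=> x /=; rewrite in_itv.
Qed.

Context (p : R) (p1 : 1 < p).

Let mcell n (k : 'I_n.+1) : measurable (cell n k%:R) := measurable_cell n k%:R.

Let cell_fin n (k : 'I_n.+1) : (l01 (cell n k%:R) < +oo)%E.
Proof. by rewrite lebesgue01_cell ltry. Qed.

Let cell_gt0 n (k : 'I_n.+1) : (0 < l01 (cell n k%:R))%E.
Proof. by rewrite lebesgue01_cell lte_fin invr_gt0 ltr0n. Qed.

Definition grid_averages n : boundedOp (Lp01 p1) (Lp01 p1) :=
  averages p1 (@mcell n) (@cell_fin n).

Local Notation LfunT := (LfunType l01 (lt1_le1_EFin p1)).

Lemma integrable_unit_itv (u : LfunT) : leb.-integrable unit_itv (EFin \o u).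
Proof.
have fin01 : (l01 unit_itv < +oo)%E.
  by rewrite lebesgue01E// lebesgue_measure_itv /= lte_fin ltr01 -EFinB ltry.
have /integrableP[mu uoo] := integrable_Lp_on measurable_unit_itv fin01 u.
by apply/integrableP; split => //; rewrite -lebesgue01_integral.
Qed.

(** At x in [0, 1[ the average is the quotient of Lebesgue's differentiation
theorem, for the function extended by zero outside [0, 1]. *)
Lemma grid_averages_step n (u : Lp01 p1) : exists f : LfunT,
  grid_averages n u = Lspace_class f /\
  forall x, 0 <= x < 1 -> (f x)%:E =
    ((leb (cell_at n x))^-1 *
      \int[leb]_(y in cell_at n x) (((u : R -> R) \_ unit_itv) y)%:E)%E.
Proof.
eexists; split; first exact: averages_step.
move=> x x01; have [i xi] := cell_atE n x01.
rewrite (average_stepE _ _ (@cell_disjoint n) u (i := i)); last first.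
  by rewrite -xi; exact: cell_at_in.
rewrite xi -[boundedOp_fun _ _]/(_ * _) lebesgue01_cell lebesgue_cell inver.
rewrite invr_eq0 pnatr_eq0 /= EFinM /Rintegral fineK; last first.
  have Iu := integrable_Lp_on (@mcell n i) (cell_fin i) (Lspace_repr u).
  exact: integrable_fin_num Iu.
congr (_ * _)%E; rewrite lebesgue01_integral; last exact: cell_sub_unit_itv.
apply: eq_integral => y /set_mem/cell_sub_unit_itv yu.
by rewrite patchE mem_set.
Qed.

Lemma grid_averages_cvg (u : Lp01 p1) (t : R) : t < `|u| ->
  \forall n \near \oo, t < `|grid_averages n u|.
Proof.
move=> tu; have [f fP] := choice (grid_averages_step ^~ u).
suff : {ae l01, forall x, f n x @[n --> \oo] --> u x}.
  by move=> /Lp_norm_lsc/(_ tu); apply: filterS => n; rewrite (fP n).1.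
have locu := integrable_locally_restrict measurable_unit_itv
  (integrable_unit_itv (Lspace_repr u)).
have FF : Filter (almost_everywhere l01) := ae_filter_ringOfSetsType _.
apply: (@filterS2 _ _ FF _ _ _ _ ae_unit_interval
  (ae_lebesgue01 (lebesgue_differentiation locu))) => x x01 ux.
have := nice_lebesgue_differentiation nicely_shrinking_cell_at locu ux.
rewrite patchE mem_set; last by rewrite /= in_itv /=; case/andP: x01 => -> /ltW.
under eq_fun do rewrite -(fP _).2//.
by move/fine_cvg.
Qed.

Lemma Lp01_neq0 : exists x : Lp01 p1, x != 0.
Proof.
exists (indic_class p1 (@mcell 0%N ord0) (cell_fin ord0)); apply/eqP => ind0.
have := average_indic p1 (@mcell 0%N) (@cell_fin 0%N) (@cell_gt0 0%N)
  (@cell_disjoint 0%N) ord0 ord0.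
by rewrite ind0 linear0 eqxx => /esym/eqP; rewrite oner_eq0.
Qed.

Lemma UBCP_Lp01 (Z : set (boundedOp (Lp01 p1) (Lp01 p1))) :
  finite_rank (Lp01 p1) (Lp01 p1) `<=` Z -> UBCP Z.
Proof.
apply: (@UBCP_operators _ _ succn
  (fun n i => average p1 (@mcell n i) (cell_fin i))
  (fun n i => indic_class p1 (@mcell n i) (cell_fin i)) grid_averages).
- exact: Lp_uniformly_convex.
- by move=> n x; exact: averagesE.
- move=> n; apply: averages_projection; first exact: cell_gt0.
  exact: cell_disjoint.
- exact: grid_averages_cvg.
- exact: Lp01_neq0.
Qed.

End UnitInterval.

Theorem corollary4p1 (R : realType) (p : R) (p1 : 1 < p) :
  (forall Z : set (boundedOp (Lp01 p1) (Lp01 p1)),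
     GRing.submod_closed (mem Z) ->
     closed Z ->
     finite_rank (Lp01 p1) (Lp01 p1) `<=` Z ->
     UBCP Z) /\
  UBCP [set: boundedOp (Lp01 p1) (Lp01 p1)].
Proof.
by split=> [Z _ _|]; [exact: UBCP_Lp01|apply: UBCP_Lp01].
Qed.
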